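(* Let $h_1,h_2$ be integers with $0<h_1\le h_2$. For every integer $n\ge 1$ let $$P^{(n)}_{(h_1,h_2)}(x)=T_0(x)+\sum_{j=1}^{n}\bigl(-h_1T_{2j-1}(x)+h_2T_{2j}(x)\bigr)+T_{2n+1}(x),$$ i.e. the polynomial of degree $2n+1$ with Chebyshev coordinates $[1,\underbrace{-h_1,h_2,-h_1,h_2,\ldots,-h_1,h_2}_{2n},1]$. Then $P^{(n)}_{(h_1,h_2)}(x)$ is hyperbolic, with all roots in the interval $[-2,2]$ except for one root $x_m=x_m(n)<-2$. Moreover $\lim_{n\to\infty}x_m=z_0+z_0^{-1}$, where $z_0$ is the smallest real root of the polynomial $z^2+h_2z-(h_1+1)$, while the largest root $x_M=x_M(n)$ tends to $2$ as $n\to\infty$.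
   Context: The Chebyshev polynomials used here are the monic integer polynomials $T_0(x)=1$ and, for $n>0$, $T_n(x)=x^n+\sum_{k=1}^{\lfloor n/2\rfloor}(-1)^k\frac nk\binom{n-k-1}{k-1}x^{n-2k}$; equivalently, for $n>0$, $T_n(2\cos\theta)=2\cos(n\theta)$ and $T_n(z+z^{-1})=z^n+z^{-n}$. Note the convention $T_0=1$ (not $2$). A polynomial has Chebyshev coordinates $[c_0,c_1,\ldots,c_d]$ if it equals $\sum_{j=0}^d c_jT_j(x)$. A real polynomial is called hyperbolic if all its complex roots are real. Roots are counted with multiplicity. *)

(* Defs.v *)
From mathcomp Require Import all_boot all_order all_algebra.
From mathcomp Require Import complex.
From mathcomp Require Import all_classical all_reals all_analysis.
Set Implicit Arguments.
Unset Strict Implicit.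
Unset Printing Implicit Defensive.
Import Order.TTheory GRing.Theory Num.Theory.
Import numFieldNormedType.Exports.
Local Open Scope ring_scope.

(* The coefficient (n / k) * binom (n - k - 1, k - 1); the division is exact
   for 0 < k <= n / 2, see chebT_coef_exact. *)
Definition chebT_coef (n k : nat) : nat := (n * 'C(n - k - 1, k - 1)) %/ k.

Lemma chebT_coef_exact (n k : nat) : (0 < k <= n./2)%N ->
  (chebT_coef n k * k = n * 'C(n - k - 1, k - 1))%N.
Proof.
case/andP => k0 kn; apply: divnK.
have ltkn : (k < n)%N.
  have k2n : (k.*2 <= n)%N by rewrite -geq_half_double.
  by apply: leq_trans k2n; rewrite -addnn -addn1 leq_add2l.
have := mul_bin_diag (n - k) (k - 1).
rewrite !subn1 !prednK ?subn_gt0 // => E.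
have -> : (n * 'C((n - k).-1, k.-1) =
           (n - k) * 'C((n - k).-1, k.-1) + k * 'C((n - k).-1, k.-1))%N.
  by rewrite -mulnDl subnK // ltnW.
by rewrite E dvdn_add // dvdn_mulr.
Qed.

(* For n = 0 the sum is empty, so chebT 0 = 1. *)
Definition chebT (n : nat) : {poly int} :=
  'X^n + \sum_(1 <= k < n./2.+1)
           ((-1) ^+ k * (chebT_coef n k)%:Z) *: 'X^(n - 2 * k).

Definition chebP (h1 h2 : int) (n : nat) : {poly int} :=
  chebT 0
  + \sum_(1 <= j < n.+1) (- h1 *: chebT (2 * j - 1) + h2 *: chebT (2 * j))
  + chebT (2 * n + 1).

Definition hyperbolic (R : rcfType) (p : {poly R}) : Prop :=
  forall z : complex R,
    root (map_poly (real_complex R) p) z -> z \is Num.real.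

Definition smallest_root (R : realDomainType) (p : {poly R}) (x : R) : Prop :=
  root p x /\ forall y : R, root p y -> x <= y.

Definition largest_root (R : realDomainType) (p : {poly R}) (x : R) : Prop :=
  root p x /\ forall y : R, root p y -> y <= x.

(* Main.v *)
(* Let S_n be the Chebyshev polynomials of the second kind, with
   S_n(2 cos t) = sin((n+1)t) / sin t.  Since T_(n+2) = S_(n+2) - S_n, the sum
   telescopes:
     P_n = S_(2n+1) + h2 S_(2n) - (h1+1) S_(2n-1) - (h2-1).
   Hence, with m = 2n+1, A = h2 - h1 cos t and B = (h1+2) sin t,
     sin t * P_n(2 cos t) = A sin(mt) + B cos(mt) - (h2-1) sin t.
   For 0 < k < m some t with k pi <= mt <= k pi + pi/2 makes A sin(mt) + B cos(mt)
   equal to (-1)^k sqrt(A^2 + B^2), which dominates (h2-1) sin t; as P_n(2) > 0,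
   these sign changes give 2n roots in ]-2,2[.  The remaining root is real, and
   lies below -2 because P_n(-2) > 0.
   With q(z) = z^2 + h2 z - (h1+1) and z < -1, the product of z^(-2n) and
   (z - 1/z) P_n(z + 1/z) tends to q(z), so that P_n changes sign between
   images of points close to z0 on either side of it. *)
Require Import Defs.
From mathcomp Require Import all_boot all_order all_algebra.
From mathcomp Require Import all_classical all_reals all_analysis.
From mathcomp Require Import complex polyrcf zify ring lra.
Import Order.TTheory GRing.Theory Num.Theory.
Import numFieldNormedType.Exports.
Local Open Scope classical_set_scope.
Local Open Scope ring_scope.

(** * Chebyshev polynomials of the second kind and the telescoped form of the sum *)

Definition chebS (n : nat) : {poly int} :=
  \sum_(0 <= k < n./2.+1) ((-1) ^+ k * 'C(n - k, k)%:Z) *: 'X^(n - 2 * k).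

(** The added terms vanish because ['C(n - k, k) = 0] once [k > n./2]. This gives sums of
    neighbouring indices matching ranges. *)
Lemma chebS_widen (n N : nat) : (n./2 < N)%N ->
  chebS n = \sum_(0 <= k < N) ((-1) ^+ k * 'C(n - k, k)%:Z) *: 'X^(n - 2 * k).
Proof.
move=> nN; rewrite (@big_cat_nat _ _ _ n./2.+1 0 N) //= -[LHS]addr0; congr (_ + _).
rewrite big_nat_cond big1 // => k /andP[/andP[nk _] _].
by rewrite bin_small ?mulr0 ?scale0r //; lia.
Qed.

Lemma chebS0 : chebS 0 = 1.
Proof. by rewrite /chebS big_nat1 mulr1 scale1r. Qed.

Lemma chebS1 : chebS 1 = 'X.
Proof. by rewrite /chebS big_nat1 mulr1 scale1r. Qed.

(** Coefficientwise this is Pascal's rule. *)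
Lemma chebS_rec (n : nat) : chebS n.+2 = 'X * chebS n.+1 - chebS n.
Proof.
rewrite (@chebS_widen n.+2 n.+2); last lia.
rewrite (@chebS_widen n.+1 n.+2); last lia.
rewrite (@chebS_widen n n.+1); last lia.
rewrite [LHS]big_nat_recl // [in RHS]big_nat_recl // mulrDr -addrA; congr (_ + _).
  by rewrite !subn0 !bin0 -scalerAr -exprS.
rewrite mulr_sumr -sumrB; apply: eq_big_nat => k kn.
rewrite -scalerAr -exprS.
have -> : (n.+2 - 2 * k.+1 = n - 2 * k)%N by lia.
have -> : (n.+2 - k.+1 = (n - k).+1)%N by lia.
have -> : (n.+1 - k.+1 = n - k)%N by lia.
rewrite binS exprS PoszD.
case: (leqP (2 * k.+1) n.+1) => h.
  have -> : ((n.+1 - 2 * k.+1).+1 = n - 2 * k)%N by lia.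
  rewrite -scalerBl; congr (_ *: _); ring.
(* Here truncated subtraction spoils the exponent of the term from [chebS n.+1], but its binomial
   coefficient is zero. *)
rewrite (@bin_small _ k.+1); last lia.
by rewrite mulr0 scale0r !add0r -scaleNr; congr (_ *: _); ring.
Qed.

(** With N = n+2 and K = k+1, the coefficients agree because (N/K) C(N-K-1, K-1) = C(N-K, K) +
    C(N-K-1, K-1). *)
Lemma chebTS (n : nat) : chebT n.+2 = chebS n.+2 - chebS n.
Proof.
rewrite /chebT /chebS /= big_add1 [in RHS]big_nat_recl //=.
rewrite mulr1 scale1r muln0 subn0 -addrA; congr (_ + _).
rewrite -sumrB; apply: eq_big_nat => k kn.
have -> : (n.+2 - 2 * k.+1 = n - 2 * k)%N by lia.
have -> : (n.+2 - k.+1 = (n - k).+1)%N by lia.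
rewrite -scalerBl; congr (_ *: _).
suff -> : chebT_coef n.+2 k.+1 = ('C((n - k).+1, k.+1) + 'C(n - k, k))%N.
  by rewrite PoszD !exprS; ring.
apply/eqP; rewrite -(@eqn_pmul2r k.+1) //; apply/eqP.
rewrite chebT_coef_exact; last lia.
have -> : (n.+2 - k.+1 - 1 = n - k)%N by lia.
have := mul_bin_diag (n - k).+1 k; rewrite !subn1 /=.
have -> : (n.+2 = (n - k).+1 + k.+1)%N by lia.
by rewrite mulnDl => ->; lia.
Qed.

Lemma chebPS (h1 h2 : int) (n : nat) :
  chebP h1 h2 n.+1 = chebS (2 * n).+3 + h2 *: chebS (2 * n).+2
    - (h1 + 1) *: chebS (2 * n).+1 - (h2 - 1)%:P.
Proof.
have T0 : chebT 0 = 1 by rewrite /chebT big_geq ?addr0.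
have T1 : chebT 1 = 'X by rewrite /chebT big_geq ?addr0.
rewrite /chebP T0.
(* The odd terms start at T_1 = S_1 and leave no boundary term; the even ones start at T_2 = S_2 -
   S_0 and leave -1. *)
have -> : \sum_(1 <= j < n.+2) (- h1 *: chebT (2 * j - 1) + h2 *: chebT (2 * j))
    = - h1 *: chebS (2 * n).+1 + h2 *: (chebS (2 * n).+2 - 1).
  elim: n => [|n IHn]; first by rewrite big_nat1 /= T1 chebTS chebS1 chebS0.
  rewrite big_nat_recr //= IHn.
  have -> : (2 * n.+2 - 1 = (2 * n).+3)%N by lia.
  have -> : (2 * n.+2 = (2 * n).+4)%N by lia.
  have -> : (2 * n.+1 = (2 * n).+2)%N by lia.
  by rewrite !chebTS !scalerBr; ring.
have -> : (2 * n.+1 + 1 = (2 * n).+3)%N by lia.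
rewrite chebTS polyCB -!mul_polyC polyCN polyCD; ring.
Qed.

Lemma chebS_size_lead (n : nat) : size (chebS n) = n.+1 /\ chebS n \is monic.
Proof.
suff [] : (size (chebS n) = n.+1 /\ chebS n \is monic) /\
  (size (chebS n.+1) = n.+2 /\ chebS n.+1 \is monic) by [].
elim: n => [|n [[sn mn] [sn1 mn1]]].
  by rewrite chebS0 chebS1 size_poly1 size_polyX monic1 monicX.
split=> //; rewrite chebS_rec.
have sX : size ('X * chebS n.+1) = n.+3.
  by rewrite mulrC size_mulX ?monic_neq0 // sn1.
have lt : (size (- chebS n) < size ('X * chebS n.+1)%R)%N.
  by rewrite sX size_polyN sn ltnS leqnSn.
rewrite size_polyDl // sX; split=> //.
by rewrite monicE lead_coefDl // [_ * chebS _]mulrC lead_coefMX; move: mn1; rewrite monicE.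
Qed.

(** * Values at 2 cos t, z + 1/z, 2 and -2; degree and leading coefficient *)

Section Evaluation.
Variable R : realType.
Implicit Types x t z : R.

Local Notation S n := (map_poly intr (chebS n) : {poly R}).

Lemma horner_chebS_rec (n : nat) x :
  (S n.+2).[x] = x * (S n.+1).[x] - (S n).[x].
Proof. by rewrite chebS_rec rmorphB rmorphM /= map_polyX !hornerE. Qed.

(** A solution of the second-order recurrence is determined by its first two values. The factor [c]
    (such as sin t or z - 1/z) keeps the closed forms free of division. *)
Lemma chebS_ind x (f : nat -> R) c : c = f 0 -> c * x = f 1 ->
  (forall n, f n.+2 = x * f n.+1 - f n) ->
  forall n, c * (S n).[x] = f n.
Proof.
move=> f0 f1 frec n.
suff [] : c * (S n).[x] = f n /\ c * (S n.+1).[x] = f n.+1 by [].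
elim: n => [|n [IH1 IH2]].
  by rewrite chebS0 chebS1 rmorph1 map_polyX !hornerE.
by split=> //; rewrite horner_chebS_rec frec -IH1 -IH2; ring.
Qed.

Lemma chebS_sin (n : nat) t :
  sin t * (S n).[2 * cos t] = sin (n.+1%:R * t).
Proof.
apply: (@chebS_ind _ (fun n => sin (n.+1%:R * t))) => [||k].
- by rewrite mul1r.
- by rewrite [2%:R * t]mulr_natl mulr2n sinD; ring.
have -> : k.+3%:R * t = k.+2%:R * t + t by rewrite -[in LHS]natr1; ring.
have -> : k.+1%:R * t = k.+2%:R * t - t by rewrite -[in RHS]natr1; ring.
by rewrite sinB sinD; ring.
Qed.

Lemma chebS_addV (n : nat) z : z != 0 ->
  (z - z^-1) * (S n).[z + z^-1] = z ^+ n.+1 - z^-1 ^+ n.+1.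
Proof.
move=> z0; apply: (@chebS_ind _ (fun n => z ^+ n.+1 - z^-1 ^+ n.+1)) => [||k].
- by rewrite !expr1.
- by rewrite mulrC subr_sqr mulrC.
by rewrite !exprS; field.
Qed.

Lemma chebS_at2 (n : nat) : (S n).[2] = n.+1%:R.
Proof.
rewrite -[LHS]mul1r; apply: (@chebS_ind _ (fun n => n.+1%:R)) => // [|k].
  by rewrite mul1r.
by rewrite -!natr1; ring.
Qed.

Lemma chebS_atN2 (n : nat) : (S n).[- 2] = (-1) ^+ n * n.+1%:R.
Proof.
rewrite -[LHS]mul1r; apply: (@chebS_ind _ (fun n => (-1) ^+ n * n.+1%:R)).
- by rewrite mul1r.
- by rewrite expr1; ring.
by move=> k; rewrite -!natr1 !exprS; ring.
Qed.

Section Coefficients.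
Variables h1 h2 : int.
Local Notation a := (h1%:~R : R).
Local Notation b := (h2%:~R : R).
Local Notation P n := (map_poly intr (chebP h1 h2 n) : {poly R}).

Lemma chebP_decomp (n : nat) :
  P n.+1 = S (2 * n).+3 + b *: S (2 * n).+2
             - (a + 1) *: S (2 * n).+1 - (b - 1)%:P.
Proof.
rewrite chebPS !rmorphB rmorphD /= !map_polyZ !rmorphD /= rmorph1.
by rewrite !map_polyC.
Qed.

Lemma horner_chebP (n : nat) x :
  (P n.+1).[x] = (S (2 * n).+3).[x] + b * (S (2 * n).+2).[x]
             - (a + 1) * (S (2 * n).+1).[x] - (b - 1).
Proof. by rewrite chebP_decomp !hornerE. Qed.

Lemma chebP_size_monic (n : nat) : size (P n.+1) = (2 * n).+4 /\ P n.+1 \is monic.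
Proof.
have sz k : size (S k) = k.+1.
  have [sk mk] := chebS_size_lead k.
  by rewrite size_map_poly_id0 // (monicP mk) rmorph1 oner_neq0.
have [_ m] := chebS_size_lead (2 * n).+3.
pose Q : {poly R} := b *: S (2 * n).+2 - (a + 1) *: S (2 * n).+1 - (b - 1)%:P.
have -> : P n.+1 = S (2 * n).+3 + Q by rewrite chebP_decomp !addrA.
have sQ : (size Q < (2 * n).+4)%N.
  rewrite ltnS (leq_trans (size_polyD _ _)) // geq_max size_polyN.
  rewrite (leq_trans (size_polyC_leq1 _)) // andbT.
  rewrite (leq_trans (size_polyD _ _)) // geq_max size_polyN.
  by rewrite !(leq_trans (size_scale_leq _ _)) ?sz.
rewrite size_polyDl sz //; split=> //.
by rewrite monicE lead_coefDl ?sz // -monicE monic_map.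
Qed.
End Coefficients.
End Evaluation.

(** * Counting roots by sign changes *)

Lemma ivt_roots (R : rcfType) (p : {poly R}) (x : nat -> R) (N : nat) :
  (forall k, (k < N)%N -> x k.+1 < x k) ->
  (forall k, (k <= N)%N -> 0 < (-1) ^+ k * p.[x k]) ->
  exists s, [/\ size s = N, uniq s, all (root p) s
             & forall r, r \in s -> x N < r < x 0].
Proof.
elim: N => [|N IH] xdec xsgn; first by exists [::].
have [||s [ss us rs Is]] := IH.
- by move=> k kN; apply: xdec; rewrite ltnS ltnW.
- by move=> k kN; apply: xsgn; rewrite leqW.
have xN := xdec N (leqnn _).
have x0 : x N <= x 0.
  elim: {1 3}N (leqnSn N) => // k IHk kN.
  by rewrite (le_trans (ltW (xdec k kN))) // IHk // ltnW.
(* The new root lies to the left of [x N], while all earlier ones lie to its right, so it is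
   distinct from them. *)
have [] := poly_ivtoo (p := p) (ltW xN).
  have := xsgn N.+1 (leqnn _); have := xsgn N (leqnSn _).
  by rewrite exprS -signr_odd; case: (odd N); rewrite ?expr0 ?expr1; nra.
move=> r; rewrite in_itv /= => /andP[r1 r2] rr.
exists (r :: s); split=> /=.
- by rewrite ss.
- by rewrite us andbT; apply/negP => /Is; lra.
- by rewrite rr.
- by move=> y; rewrite inE => /predU1P[->|/Is]; lra.
Qed.

(** * Trigonometric form and alternating signs *)

Section Trig.
Variable R : realType.
Implicit Types t u : R.

Lemma cosDkpi (k : nat) u : cos (k%:R * pi + u) = (-1) ^+ k * cos u.
Proof.
elim: k => [|k IH]; first by rewrite mul0r add0r mul1r.
rewrite -natr1 (_ : _ + u = (k%:R * pi + u) + pi); last by ring.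
by rewrite cosDpi IH exprS; ring.
Qed.

Lemma sinDkpi (k : nat) u : sin (k%:R * pi + u) = (-1) ^+ k * sin u.
Proof.
elim: k => [|k IH]; first by rewrite mul0r add0r mul1r.
rewrite -natr1 (_ : _ + u = (k%:R * pi + u) + pi); last by ring.
by rewrite sinDpi IH exprS; ring.
Qed.

Variables h1 h2 : int.
Hypotheses (h1_gt0 : 0 < h1) (h1_le_h2 : h1 <= h2).
Local Notation a := (h1%:~R : R).
Local Notation b := (h2%:~R : R).
Local Notation P n := (map_poly intr (chebP h1 h2 n) : {poly R}).

Lemma chebP_sin (n : nat) t :
  sin t * (P n.+1).[2 * cos t] =
    (b - a * cos t) * sin ((2 * n).+3%:R * t)
    + (a + 2) * sin t * cos ((2 * n).+3%:R * t) - (b - 1) * sin t.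
Proof.
have -> : sin t * (P n.+1).[2 * cos t] = sin ((2 * n).+4%:R * t)
    + b * sin ((2 * n).+3%:R * t) - (a + 1) * sin ((2 * n).+2%:R * t)
    - (b - 1) * sin t.
  by rewrite horner_chebP -!chebS_sin; ring.
set m := (2 * n).+3%:R.
have -> : (2 * n).+4%:R * t = m * t + t by rewrite -natr1 -/m; ring.
have -> : (2 * n).+2%:R * t = m * t - t.
  by rewrite /m -[in RHS]natr1; ring.
by rewrite sinB sinD; ring.
Qed.

Lemma h1_ge1 : 1 <= a. Proof. by rewrite -[1]/(1%:~R) ler_int. Qed.
Lemma h1_le_h2_real : a <= b. Proof. by rewrite ler_int. Qed.

(* (h2 - h1 c)^2 + h1^2 s^2 - h2^2 s^2 = (h2 c - h1)^2 when c^2 + s^2 = 1. *)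
Lemma amplitude_gt t : 0 < sin t ->
  ((b - 1) * sin t) ^+ 2 < (b - a * cos t) ^+ 2 + ((a + 2) * sin t) ^+ 2.
Proof.
move=> st; have a1 := h1_ge1; have ab := h1_le_h2_real.
have [cs s2] := (cos2Dsin2 t, mulr_gt0 st st).
have : 0 <= (b * cos t - a) ^+ 2 by exact: sqr_ge0.
move: cs s2; rewrite !expr2; move: (sin t) (cos t) => s c cs s2 h.
have h' : b * b * (s * s) <= (b - a * c) * (b - a * c) + a * a * (s * s).
  rewrite -subr_ge0; have -> : s * s = 1 - c * c by lra.
  by move: h; lra.
(* The slack is ((a+2)^2 - a^2) + (b^2 - (b-1)^2) = 4a + 2b + 3. *)
have : 0 < (4 * a + 2 * b + 3) * (s * s) by rewrite mulr_gt0 //; lra.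
move: h'; lra.
Qed.

(** The coefficients A and B of sin(mt) and cos(mt) depend on t, so the point of full amplitude has
    no explicit formula. The intermediate value theorem finds it, in terms of the phase u = mt - k
    pi in [0, pi/2]. *)
Lemma chebP_alternates (n k : nat) : (0 < k < (2 * n).+3)%N ->
  exists t, [/\ k%:R * pi <= (2 * n).+3%:R * t,
    (2 * n).+3%:R * t <= k%:R * pi + pi / 2
    & 0 < (-1) ^+ k * (P n.+1).[2 * cos t]].
Proof.
move=> /andP[k0 kn]; set m : R := (2 * n).+3%:R.
have m0 : 0 < m by rewrite ltr0n.
have p0 : 0 < pi :> R := pi_gt0 R.
pose T u := (k%:R * pi + u) / m.
have mT u : m * T u = k%:R * pi + u by rewrite /T; field; lra.
have T_itv u : 0 <= u -> u <= pi / 2 -> 0 < T u < pi.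
  move=> u0 u1; rewrite /T divr_gt0 //=; last first.
    by rewrite ltr_wpDr // mulr_gt0 // ltr0n.
  rewrite ltr_pdivrMr //.
  have : (k.+1%:R <= m) by rewrite ler_nat.
  rewrite -natr1 => km.
  have := ler_wpM2r (ltW p0) km; lra.
have a1 := h1_ge1; have ab := h1_le_h2_real.
(* A zero of G is a point where (sin u, cos u) is proportional to (A, B). *)
pose G u := (b - a * cos (T u)) * cos u - (a + 2) * sin (T u) * sin u.
have Gc : {within `[0, pi / 2], continuous G}.
  apply: continuous_subspaceT => u.
  have Tc : T v @[v --> u] --> T u.
    by apply: cvgM; [apply: cvgD; [exact: cvg_cst|exact: cvg_id]|exact: cvg_cst].
  have cTc : cos (T v) @[v --> u] --> cos (T u).
    by apply: continuous_cvg Tc; exact: continuous_cos.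
  have sTc : sin (T v) @[v --> u] --> sin (T u).
    by apply: continuous_cvg Tc; exact: continuous_sin.
  exact: (cvgB (cvgM (cvgB (cvg_cst _) (cvgM (cvg_cst _) cTc))
    (@continuous_cos R u)) (cvgM (cvgM (cvg_cst _) sTc) (@continuous_sin R u))).
(* Strictness survives h1 = h2 because [T u > 0] forces cos below 1. *)
have Apos u : 0 <= u -> u <= pi / 2 -> 0 < b - a * cos (T u).
  move=> u0 u1; have /andP[T0 T1] := T_itv u u0 u1.
  have c1 : cos (T u) < 1.
    by rewrite -cos0 ltr_cos // in_itv /= ?lexx ltW // ltW.
  have : a * cos (T u) < a * 1 by rewrite ltr_pM2l //; lra.
  lra.
have [||u] := IVT (v := 0) _ Gc.
- lra.
- have G0 : 0 <= G 0.
    by rewrite /G sin0 cos0 mulr0 subr0 mulr1 ltW // Apos //; lra.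
  have G1 : G (pi / 2) <= 0.
    rewrite /G sin_pihalf cos_pihalf mulr0 sub0r oppr_le0 mulr1 mulr_ge0 //.
      lra.
    by rewrite ltW // sin_gt0_pi // T_itv //; lra.
  by rewrite ge_min G1 orbT le_max G0.
rewrite in_itv /= => /andP[u0 u1] Gu.
exists (T u); rewrite mT; split; [lra|lra|].
have /andP[T0 T1] := T_itv u u0 u1.
have st : 0 < sin (T u) by rewrite sin_gt0_pi // T0.
rewrite -(pmulr_rgt0 _ st) mulrCA chebP_sin mT sinDkpi cosDkpi.
have su : 0 <= sin u by rewrite sin_ge0_pi //; lra.
have cu : 0 <= cos u by rewrite cos_ge0_pihalf //; lra.
have Au := Apos u u0 u1; have amp := amplitude_gt (T u) st.
set A := b - _ in Au amp Gu *; set B := (a + 2) * _ in amp Gu *.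
have B0 : 0 <= B by rewrite mulr_ge0 //; lra.
(* [V ^+ 2] plus the square of [G u] is [A ^+ 2 + B ^+ 2]; as [G u = 0], [V] is the full
   amplitude. *)
set V := A * sin u + B * cos u.
have V2 : V ^+ 2 = A ^+ 2 + B ^+ 2.
  rewrite -[RHS]mulr1 -(cos2Dsin2 u) /V.
  have : (A * cos u - B * sin u) ^+ 2 = 0 by rewrite (_ : _ - _ = 0) ?expr0n.
  by lra.
have V0 : 0 <= V by rewrite addr_ge0 // mulr_ge0 // ltW.
have C0 : 0 <= (b - 1) * sin (T u) by rewrite mulr_ge0 ?(ltW st) //; lra.
have VC : (b - 1) * sin (T u) < V.
  by rewrite -(@ltr_pXn2r _ 2) ?V2 // nnegrE.
have -> : A * ((-1) ^+ k * sin u) + B * ((-1) ^+ k * cos u) = (-1) ^+ k * V.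
  by rewrite /V; ring.
rewrite mulrBr mulrA -expr2 sqrr_sign mul1r -signr_odd.
by case: (odd k); rewrite ?expr0 ?expr1; lra.
Qed.

End Trig.

(** * Location of all the roots *)

Section Roots.
Variable R : realType.
Variables h1 h2 : int.
Hypotheses (h1_gt0 : 0 < h1) (h1_le_h2 : h1 <= h2).
Local Notation a := (h1%:~R : R).
Local Notation b := (h2%:~R : R).
Local Notation P n := (map_poly intr (chebP h1 h2 n) : {poly R}).
Let a1 : 1 <= a := @h1_ge1 R h1 h1_gt0.
Let ab : a <= b := @h1_le_h2_real R h1 h2 h1_le_h2.

(** The value is 3 + 2 (n+1) (h2 - h1). *)
Lemma chebP_at2 (n : nat) : 0 < (P n.+1).[2].
Proof.
rewrite horner_chebP !chebS_at2 -!natr1 natrM.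
have : 0 <= n%:R :> R by [].
have : 0 <= n%:R * (b - a) by rewrite mulr_ge0 // subr_ge0.
by move: a1 ab; lra.
Qed.

(** The value is 2 (n+1) (h1 + h2) - 1. *)
Lemma chebP_atN2 (n : nat) : 0 < (P n.+1).[- 2].
Proof.
rewrite horner_chebP !chebS_atN2 !exprS mul2n -signr_odd odd_double expr0.
rewrite -!natr1 -mul2n natrM.
have : 0 <= n%:R :> R by [].
have : 0 <= n%:R * (b + a) by rewrite mulr_ge0 //; move: a1 ab; lra.
by move: a1 ab; lra.
Qed.

(** Of the 2n+3 roots, 2n+2 come from sign changes, so the last factor is linear and its root [w] is
    real. The cosine bound, which drives the largest root to 2, uses t_1 <= (3/2) pi / (2n+3),
    weakened to the denominator n+2. *)
Lemma chebP_factor (n : nat) : exists (w : R) (s : seq R),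
  [/\ P n.+1 = \prod_(r <- w :: s) ('X - r%:P),
      w < -2, forall r, r \in s -> -2 < r < 2
    & exists2 r, r \in s & 2 * cos (3 / 2 * pi / n.+2%:R) <= r].
Proof.
set N := (2 * n).+2; set m : R := N.+1%:R.
have mn : n.+2%:R <= m by rewrite ler_nat !ltnS leqW // leq_pmull.
have m0 : 0 < m by rewrite ltr0n.
have p0 : 0 < pi :> R := pi_gt0 R.
have alt (k : nat) := @chebP_alternates R h1 h2 h1_gt0 h1_le_h2 n k.
have [sP mP] := @chebP_size_monic R h1 h2 n.
move: alt sP mP (chebP_at2 n) (chebP_atN2 n).
move: (P n.+1) => p alt sP mP p2 pN2.
have /choice[t Ht] : forall k, exists t, (0 < k < N.+1)%N ->
    [/\ k%:R * pi <= m * t, m * t <= k%:R * pi + pi / 2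
      & 0 < (-1) ^+ k * (p).[2 * cos t]].
  move=> k; have [kN|] := boolP (0 < k < N.+1)%N; last by exists 0.
  by have [t] := alt k kN; exists t.
have t_itv k : (0 < k < N.+1)%N -> 0 < t k < pi.
  move=> kN; have [l u _] := Ht k kN; move/andP: kN => [k0 kN].
  have k1 : 1 <= k%:R :> R by rewrite ler1n.
  have km : k%:R + 1 <= m :> R by rewrite natr1 ler_nat.
  have km' := ler_wpM2r (ltW p0) km; have k1' := ler_wpM2r (ltW p0) k1.
  rewrite -(pmulr_rgt0 _ m0) -(ltr_pM2l m0 _ pi); apply/andP; split; lra.
have tI k : (0 < k < N.+1)%N -> t k \in `[0, pi].
  by move=> /t_itv /andP[? ?]; rewrite in_itv /= !ltW.
have I0 : 0 \in `[0, pi : R] by rewrite in_itv /= lexx ltW.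
have Ipi : pi \in `[0, pi : R] by rewrite in_itv /= lexx ltW.
(* The alternation starts at k = 1; the endpoint 2, where the polynomial is positive, supplies k =
   0. *)
pose x k := if k is 0 then 2 else 2 * cos (t k).
have xdec k : (k < N)%N -> x k.+1 < x k.
  case: k => [|k] kN /=.
    have /andP[? ?] := t_itv 1%N isT.
    by rewrite -[X in _ < X]mulr1 ltr_pM2l // -cos0 ltr_cos // tI.
  have k1 : (0 < k.+1 < N.+1)%N by rewrite /= ltnS ltnW.
  have k2 : (0 < k.+2 < N.+1)%N by rewrite /= ltnS.
  (* The [t k] increase because the windows [k pi, k pi + pi/2] containing [m * t k] are
     disjoint. *)
  rewrite ltr_pM2l // ltr_cos ?tI // -(ltr_pM2l m0).
  have [_ u1 _] := Ht _ k1; have [u2 _ _] := Ht _ k2.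
  by move: u1 u2; rewrite -[in k.+2%:R * _]natr1; lra.
have xsgn k : (k <= N)%N -> 0 < (-1) ^+ k * (p).[x k].
  case: k => [|k] kN; first by rewrite mul1r.
  by have [] := Ht k.+1 kN.
have [s [sN us rs Is]] := @ivt_roots _ _ _ _ xdec xsgn.
have xN : -2 < x N.
  have /andP[_ ?] := t_itv N (leqnn _).
  have : -1 < cos (t N) by rewrite -cospi ltr_cos // tI //= leqnn.
  by rewrite /x /N /=; lra.
have Is2 r : r \in s -> -2 < r < 2 by move=> /Is/andP[l u]; rewrite (lt_trans xN l).
have ms : \prod_(r <- s) ('X - r%:P) \is monic by exact: monic_prod_XsubC.
have : \prod_(r <- s) ('X - r%:P) %| p.
  by rewrite uniq_roots_dvdp // uniq_rootsE.
move=> /dvdpP[q Pq].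
have mq : q \is monic by rewrite -(monicMr q ms) -Pq.
have sq : size q = 2%N.
  have := size_Mmonic (monic_neq0 mq) ms; rewrite -Pq sP size_prod_XsubC sN.
  by rewrite addnS /= -[(2 * n).+4]/(2 + N)%N => /addIn.
have q1 : q`_1 = 1 by move/monicP: mq; rewrite lead_coefE sq.
have qE : q = 'X - (- q`_0)%:P.
  apply/polyP => i; rewrite coefB coefX coefC.
  case: i => [|[|i]]; rewrite ?q1 /= ?sub0r ?opprK ?subr0 //.
  by rewrite oppr0 nth_default ?sq.
have PE : p = \prod_(r <- - q`_0 :: s) ('X - r%:P).
  by rewrite big_cons -qE.
exists (- q`_0), s; have w2 : - q`_0 < -2.
  move: pN2; rewrite PE big_cons hornerM horner_prod.
  (* Since [size s] is even and every [r + 2] is positive, the sign at -2 is that of -2 - w. *)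
  have -> : \prod_(r <- s) ('X - r%:P).[- 2] = (-1) ^+ size s * \prod_(r <- s) (r + 2).
    elim: (s) => [|r l IH]; first by rewrite !big_nil mulr1.
    by rewrite !big_cons IH exprS !hornerE /=; ring.
  rewrite -signr_odd sN /N mul2n /= negbK odd_double expr0 mul1r.
  have : 0 < \prod_(r <- s) (r + 2).
    by rewrite big_seq_cond prodr_gt0 // => r /andP[/Is2 ? _]; lra.
  move=> h; rewrite pmulr_lgt0 // !hornerE; lra.
split; [exact: PE|exact: w2|exact: Is2|].
(* A root between [x 1] and 2 exceeds -2, so it is not [w] and belongs to [s]. *)
have x12 : x 1%N < 2 := xdec 0%N isT.
have [] := poly_ivtoo (p := p) (ltW x12).
  rewrite pmulr_llt0 ?p2 //.
  by have := xsgn 1%N isT; rewrite expr1; lra.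
move=> r; rewrite in_itv /= => /andP[r1 r2] rr.
exists r.
  move: rr; rewrite PE root_prod_XsubC inE => /predU1P[rw|//].
  have /andP[_ ?] := t_itv 1%N isT.
  have : -1 < cos (t 1%N) by rewrite -cospi ltr_cos // tI.
  by move: r1; rewrite /x; lra.
apply: le_trans (ltW r1); rewrite ler_pM2l //.
have [_ u1 _] := Ht 1%N isT.
have n0 : 0 < n.+2%:R :> R by rewrite ltr0n.
have /andP[t1 _] := t_itv 1%N isT.
have t0 : t 1%N <= 3 / 2 * pi / n.+2%:R.
  by rewrite ler_pdivlMr // mulrC; have := ler_wpM2r (ltW t1) mn; lra.
have n2 : 2 <= n.+2%:R :> R by rewrite ler_nat.
have tmax : 3 / 2 * pi / n.+2%:R <= pi :> R.
  by rewrite ler_pdivrMr //; have := ler_wpM2r (ltW p0) n2; lra.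
have Imax : 3 / 2 * pi / n.+2%:R \in `[0, pi : R].
  by rewrite in_itv /= tmax (le_trans (ltW t1) t0).
by rewrite leNgt (ltr_cos Imax (tI 1%N isT)) -leNgt.
Qed.
End Roots.

(** * Products of real linear factors, and maxima of finite sequences *)

Lemma hyperbolic_prod_XsubC (R : rcfType) (s : seq R) :
  hyperbolic (\prod_(r <- s) ('X - r%:P)).
Proof.
move=> z; rewrite rmorph_prod.
under eq_bigr do rewrite /= map_polyXsubC.
rewrite -(big_map (real_complex R) xpredT (fun y => 'X - y%:P)) root_prod_XsubC.
by move=> /mapP[r _ ->]; rewrite realE -[0]/(real_complex R 0) !lecR; exact: le_total.
Qed.

Lemma mup_prod_XsubC_cons (R : fieldType) (w : R) (s : seq R) : w \notin s ->
  mup w (\prod_(r <- w :: s) ('X - r%:P)) = 1%N.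
Proof.
move=> ws; rewrite big_cons mupMl ?root_prod_XsubC //.
by rewrite -['X - _]expr1 mup_XsubCX eqxx.
Qed.

Lemma seq_max_exists (R : realDomainType) (s : seq R) (x : R) : x \in s ->
  exists2 M, M \in s & forall y, y \in s -> y <= M.
Proof.
move=> xs; exists (\big[Num.max/x]_(y <- s) y).
  rewrite big_seq; elim/big_ind: _ => // y z ys zs.
  by case: leP.
by move=> y ys; exact: le_bigmax_seq.
Qed.

(** * Asymptotic sign left of -2 and the limiting quadratic *)

Section Limits.
Variable R : realType.

(** The increment of z + 1/z is (w - z) (1 - 1/(zw)) with zw > 1. Thus the map is increasing and
    1-Lipschitz here, which carries neighbourhoods of z0 to neighbourhoods of z0 + 1/z0. *)
Lemma addV_lt (z w : R) : z < w -> w <= -1 ->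
  z + z^-1 < w + w^-1 < z + z^-1 + (w - z).
Proof.
move=> zw w1; have zw1 : 1 < z * w by nra.
have [z0 w0] : z != 0 /\ w != 0 by split; lra.
have i0 : 0 < (z * w)^-1 by rewrite invr_gt0; lra.
have i1 : (z * w)^-1 < 1 by rewrite invf_lt1 //; lra.
have E : w + w^-1 = z + z^-1 + (w - z) * (1 - (z * w)^-1).
  by field; rewrite z0 w0.
rewrite E; have := mulr_gt0 (_ : 0 < w - z) i0.
have := mulr_gt0 (_ : 0 < w - z) (_ : 0 < 1 - (z * w)^-1).
rewrite !subr_gt0 => /(_ zw i1) ? /(_ zw) ?; lra.
Qed.

Variables h1 h2 : int.
Hypotheses (h1_gt0 : 0 < h1) (h1_le_h2 : h1 <= h2).
Local Notation a := (h1%:~R : R).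
Local Notation b := (h2%:~R : R).
Local Notation P n := (map_poly intr (chebP h1 h2 n) : {poly R}).

Let q (z : R) := z ^+ 2 + b * z - (a + 1).

(** The limiting quadratic appears because the leading powers z^(2n+4), z^(2n+3), z^(2n+2) share the
    factor z^(2n+2). *)
Lemma chebP_addV (n : nat) (z : R) : z != 0 ->
  (z - z^-1) * (P n.+1).[z + z^-1] =
    z ^+ 2 ^+ n.+1 * q z - z^-1 ^+ 2 ^+ n.+1 * q z^-1 - (b - 1) * (z - z^-1).
Proof.
move=> z0; have E k := @chebS_addV R k z z0.
transitivity ((z - z^-1) * (map_poly intr (chebS (2 * n).+3)).[z + z^-1]
   + b * ((z - z^-1) * (map_poly intr (chebS (2 * n).+2)).[z + z^-1])
   - (a + 1) * ((z - z^-1) * (map_poly intr (chebS (2 * n).+1)).[z + z^-1])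
   - (b - 1) * (z - z^-1)).
  by rewrite horner_chebP; ring.
by rewrite !E -!exprM mulnS /q !exprS; ring.
Qed.

(** After scaling by z^(-2n-2), the term [q z] dominates; since z - 1/z < 0 for z < -1, the
    polynomial eventually has the sign opposite to [q z]. *)
Lemma chebP_eventually_sign (z : R) : z < -1 -> q z != 0 ->
  \forall n \near \oo, q z * (P n.+1).[z + z^-1] < 0.
Proof.
move=> z1 qz0; have z0 : z != 0 by lra.
have zi : z^-1 ^+ 2 < 1.
  by rewrite exprVn invf_lt1 ?exprn_even_gt0 //; nra.
pose u n := z^-1 ^+ 2 ^+ n.+1.
have u0 : u n @[n --> \oo] --> (0 : R).
  rewrite (cvg_shiftS (fun n => z^-1 ^+ 2 ^+ n)).
  by apply: cvg_expr; rewrite ger0_norm // sqr_ge0.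
have upos n : 0 < u n by rewrite exprn_gt0 // exprn_even_gt0 //= invr_eq0.
pose F n := q z * (q z - u n * u n * q z^-1 - u n * ((b - 1) * (z - z^-1))).
have FE n : F n = (u n * (z - z^-1)) * (q z * (P n.+1).[z + z^-1]).
  rewrite [RHS]mulrCA -mulrA chebP_addV // /F; congr (_ * _).
  have uz : u n * z ^+ 2 ^+ n.+1 = 1.
    by rewrite /u -exprMn -exprMn mulVf // !expr1n.
  by rewrite -/(u n) -{1}[q z]mul1r -uz; ring.
(* The limit is [q z ^+ 2], left unsimplified so that it matches the limit rules. *)
have Flim : F n @[n --> \oo] --> q z * (q z - 0 * 0 * q z^-1 - 0 * ((b - 1) * (z - z^-1))).
  apply: cvgM; first exact: cvg_cst.
  apply: cvgB; last by apply: cvgM => //; exact: cvg_cst.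
  apply: cvgB; first exact: cvg_cst.
  by apply: cvgM; [exact: cvgM|exact: cvg_cst].
have l0 : 0 < q z * (q z - 0 * 0 * q z^-1 - 0 * ((b - 1) * (z - z^-1))).
  by rewrite !mul0r !subr0 -expr2 exprn_even_gt0.
have : \forall n \near \oo, 0 < F n by exact: cvgr_gt Flim _ l0.
apply: filterS => n; rewrite FE nmulr_rgt0 //.
rewrite pmulr_rlt0 // subr_lt0 -(ltr_nM2l (_ : z < 0)); last lra.
by rewrite mulfV //; nra.
Qed.

Lemma smallest_root_quadratic : exists z0 : R,
  [/\ smallest_root ('X^2 + b *: 'X - (h1 + 1)%:~R%:P) z0, z0 < -1,
      forall z, z < z0 -> 0 < q z & forall z, z0 < z -> z < -1 -> q z < 0].
Proof.
have a1 := @h1_ge1 R h1 h1_gt0; have ab := @h1_le_h2_real R h1 h2 h1_le_h2.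
pose d := Num.sqrt (b ^+ 2 + 4 * (a + 1)).
have d2 : d ^+ 2 = b ^+ 2 + 4 * (a + 1).
  by rewrite sqr_sqrtr // addr_ge0 ?sqr_ge0 //; lra.
have d0 : 0 <= d by exact: sqrtr_ge0.
(* [db] makes the larger root positive; [db2] puts the smaller one below -1. *)
have db : b < d by nra.
have db2 : 2 - b < d by nra.
pose z0 := (- b - d) / 2.
have qE z : q z = (z - z0) * (z - (- b + d) / 2).
  rewrite /q (_ : a + 1 = (d ^+ 2 - b ^+ 2) / 4); last by rewrite d2; field.
  by rewrite /z0; field.
have hE z : ('X^2 + b *: 'X - (h1 + 1)%:~R%:P).[z] = q z.
  by rewrite !hornerE intrD.
exists z0; split.
- split; first by rewrite rootE hE qE subrr mul0r.
  move=> y; rewrite rootE hE qE mulf_eq0 !subr_eq0 => /orP[] /eqP ->; rewrite /z0; lra.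
- rewrite /z0; lra.
- by move=> z zz; rewrite qE nmulr_rgt0; [rewrite subr_lt0|]; move: zz; rewrite /z0; lra.
- by move=> z zz z1; rewrite qE pmulr_rlt0; move: zz; rewrite /z0; lra.
Qed.

End Limits.

(** * The extreme roots for each index, and their limits *)

Lemma chebP_extreme_roots (R : realType) (h1 h2 : int) (h1_gt0 : 0 < h1)
    (h1_le_h2 : h1 <= h2) (n : nat) :
  let p : {poly R} := map_poly intr (chebP h1 h2 n.+1) in
  exists w M : R,
  [/\ hyperbolic p, w < -2, mup w p = 1%N,
      forall x : R, root p x -> x != w -> -2 <= x <= 2
    & largest_root p M /\ 2 * cos (3 / 2 * pi / n.+2%:R) <= M <= 2].
Proof.
move=> p; have [w [s]] := @chebP_factor R h1 h2 h1_gt0 h1_le_h2 n.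
rewrite -/p; move: p => p [-> w2 Is [r rs rM]].
have [M Ms Mmax] := seq_max_exists _ _ _ rs.
have /andP[Ml Mu] := Is M Ms.
exists w, M; split.
- exact: hyperbolic_prod_XsubC.
- exact: w2.
- by rewrite mup_prod_XsubC_cons //; apply/negP => /Is; lra.
- move=> x; rewrite root_prod_XsubC inE => /orP[->//|/Is/andP[l u] _].
  by rewrite !ltW.
- split; last by rewrite (le_trans rM (Mmax r rs)) ltW.
  split; first by rewrite root_prod_XsubC inE Ms orbT.
  move=> y; rewrite root_prod_XsubC inE => /predU1P[->|/Mmax //].
  by rewrite ltW // (lt_trans w2).
Qed.

Theorem theorem5p2 (R : realType) (h1 h2 : int)
    (h1_gt0 : 0 < h1) (h1_le_h2 : h1 <= h2) :
  let P (n : nat) : {poly R} := map_poly intr (chebP h1 h2 n) in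
  exists xm xM : nat -> R,
  [/\ forall n : nat, (1 <= n)%N ->
        [/\ hyperbolic (P n),
            xm n < -2,
            mup (xm n) (P n) = 1%N,
            forall x : R, root (P n) x -> x != xm n -> -2 <= x <= 2
          & largest_root (P n) (xM n)],
      exists2 z0 : R,
        smallest_root ('X^2 + h2%:~R *: 'X - (h1 + 1)%:~R%:P) z0
        & xm n @[n --> \oo] --> z0 + z0^-1
    & xM n @[n --> \oo] --> (2 : R)].
Proof.
move=> P.
have /choice[xm /choice[xM H]] := @chebP_extreme_roots R h1 h2 h1_gt0 h1_le_h2.
(* The chosen sequences are indexed by n - 1; the values at 0 are irrelevant. *)
exists (fun n => xm n.-1), (fun n => xM n.-1); split.
- by case=> // n _; have [? ? ? ? []] := H n.
- have [z0 [z0r z01 qpos qneg]] := @smallest_root_quadratic R h1 h2 h1_gt0 h1_le_h2.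
  exists z0 => //.
  rewrite -(cvg_shiftS (fun n => xm n.-1)) /=.
  apply/cvgrPdist_lt => e e0.
  (* The first bound keeps the images of z0 - d and z0 + d within e of z0 + 1/z0; the second keeps
     z0 + d below -1. *)
  pose d := Num.min (e / 2) ((-1 - z0) / 2).
  have d0 : 0 < d by rewrite lt_min !divr_gt0 //; lra.
  have [de dz] : d < e /\ z0 + d < -1.
    have : d <= e / 2 by rewrite ge_min lexx.
    have : d <= (-1 - z0) / 2 by rewrite ge_min lexx orbT.
    by split; lra.
  have /andP[l1 l2] : z0 - d + (z0 - d)^-1 < z0 + z0^-1
      < z0 - d + (z0 - d)^-1 + (z0 - (z0 - d)) by apply: addV_lt; lra.
  have /andP[u1 u2] : z0 + z0^-1 < z0 + d + (z0 + d)^-1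
      < z0 + z0^-1 + (z0 + d - z0) by apply: addV_lt; lra.
  (* Comparison with the image -2 of -1 places the bracketing interval left of -2, so a root in it
     can only be [xm n]. *)
  have /andP[v _] : z0 + d + (z0 + d)^-1 < -1 + (-1)^-1
      < z0 + d + (z0 + d)^-1 + (-1 - (z0 + d)) by apply: addV_lt; lra.
  rewrite invrN1 in v.
  have ql := qpos (z0 - d) (_ : z0 - d < z0).
  have qr := qneg (z0 + d) (_ : z0 < z0 + d) dz.
  have {}ql := ql ltac:(lra); have {}qr := qr ltac:(lra).
  have sl := @chebP_eventually_sign R h1 h2 (z0 - d) ltac:(lra) (lt0r_neq0 ql).
  have sr := @chebP_eventually_sign R h1 h2 (z0 + d) dz (ltr0_neq0 qr).
  apply: filterS2 sl sr => n; rewrite (pmulr_rlt0 _ ql) (nmulr_rlt0 _ qr).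
  have [_ _ _ uniq_w _] := H n; move: uniq_w; rewrite -/(P n.+1).
  move: (P n.+1) => p uniq_w pl pr.
  have [||r] := @poly_ivtoo _ p (z0 - d + (z0 - d)^-1) (z0 + d + (z0 + d)^-1).
  + lra.
  + by rewrite nmulr_rlt0.
  rewrite in_itv /= => /andP[rl rr] pr0.
  have -> : xm n = r.
    apply/eqP; rewrite eq_sym; apply/negPn/negP => rw.
    by have := uniq_w r pr0 rw; lra.
  by rewrite ltr_norml; apply/andP; split; lra.
rewrite -(cvg_shiftS (fun n => xM n.-1)) /=.
have lim0 : 3 / 2 * pi / n.+2%:R @[n --> \oo] --> (0 : R).
  have hn : n.+2%:R^-1 @[n --> \oo] --> (0 : R).
    by rewrite (cvg_shiftS (@harmonic R)); exact: cvg_harmonic.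
  by rewrite -(mulr0 (3 / 2 * pi)); exact: (cvgM (cvg_cst _) hn).
have lim1 : cos (3 / 2 * pi / n.+2%:R) @[n --> \oo] --> cos (0 : R).
  by apply: continuous_cvg lim0; exact: continuous_cos.
have lim2 : 2 * cos (3 / 2 * pi / n.+2%:R) @[n --> \oo] --> (2 : R).
  by have := cvgM (cvg_cst (2 : R)) lim1; rewrite cos0 mulr1; apply.
(* The largest root is squeezed between the cosine bound and 2. *)
apply: squeeze_cvgr lim2 (cvg_cst _).
by near=> n; have [_ _ _ _ []] := H n.
Unshelve. all: by end_near.
Qed.
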